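(* Let $S$ be a semilattice-ordered semigroup and let $\mathrm{cl}$ be an algebraic closure operator on $S$. Let $X=\{A\in\mathcal{P}(S)\mid A^{\mathrm{cl}}=A\}$ and $A\star B=(AB)^{\mathrm{cl}}$ for $A,B\in X$. Suppose that $(X,\star)$ is a semilattice. Then the following conditions are equivalent: (1) the map $\star:X\times X\to X$ is spectral; (2) for every $B\in X$, the right translation $R_B:X\to X$, $R_B(A)=A\star B$, is spectral; (3) for every $A\in X$, the left translation $L_A:X\to X$, $L_A(B)=A\star B$, is spectral.
   Context: A semilattice is a commutative semigroup in which every element is idempotent. A semilattice-ordered semigroup is a triple $(S,\cdot,\lor)$ with $S$ nonempty, $(S,\cdot)$ a semigroup, $(S,\lor)$ a semilattice, and $x(y\lor z)=xy\lor xz$, $(x\lor y)z=xz\lor yz$ for all $x,y,z\in S$. For $A,B\subseteq S$, $AB=\{ab\mid a\in A,b\in B\}$. $\mathcal{P}(S)$ is the power set of $S$ and $\mathcal{P}_{\mathrm{fin}}(A)$ is the set of finite subsets of $A$. A closure operator on $S$ is a map $\mathrm{cl}:\mathcal{P}(S)\to\mathcal{P}(S)$, written $A\mapsto A^{\mathrm{cl}}$, which is extensive, idempotent and order-preserving for inclusion. It is algebraic if $A^{\mathrm{cl}}=\bigcup\{F^{\mathrm{cl}}\mid F\in\mathcal{P}_{\mathrm{fin}}(A)\}$ for every $A\subseteq S$. The hull-kernel topology on $\mathcal{P}(S)$ has open subbasis $D(F)=\{A\in\mathcal{P}(S)\mid F\nsubseteq A\}$, $F\in\mathcal{P}_{\mathrm{fin}}(S)$.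 $X$ carries the subspace topology; since $\mathrm{cl}$ is algebraic, $X$ is a spectral space (quasi-compact, $T_0$, sober, with quasi-compact opens closed under finite intersections and forming a basis), and $X\times X$ with the product topology is a spectral space. A map between spectral spaces is spectral if the preimage of every quasi-compact open set is quasi-compact and open. *)

(* Defs.v *)
From HB Require Import structures.
From mathcomp Require Import all_boot monoid.
From mathcomp Require Import all_classical topology.

Set Implicit Arguments.
Unset Strict Implicit.
Unset Printing Implicit Defensive.

Local Open Scope classical_set_scope.

Definition is_semilattice {T : Type} (op : T -> T -> T) : Prop :=
  [/\ associative op, commutative op & idempotent_op op].

(* The multiplication is the one of [semigroupType], written [x * y] in
   [group_scope]. The [choiceType] structure carried by [semigroupType] is no
   restriction: classically, every type has one. *)
HB.mixin Record Semigroup_isSemilatticeOrdered S & Semigroup S := {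
  slo_nonempty : [set: S] !=set0;
  slo_join : S -> S -> S;
  slo_join_semilattice : is_semilattice slo_join;
  slo_mul_joinr : forall x y z : S,
    (x * slo_join y z = slo_join (x * y) (x * z))%g;
  slo_mul_joinl : forall x y z : S,
    (slo_join x y * z = slo_join (x * z) (y * z))%g
}.

#[short(type="semilatticeOrderedSemigroupType")]
HB.structure Definition SemilatticeOrderedSemigroup :=
  {S of Semigroup_isSemilatticeOrdered S & Semigroup S}.

Record closure_operator (S : Type) := ClosureOperator {
  cl_fun :> set S -> set S;
  cl_extensive : forall A, A `<=` cl_fun A;
  cl_idempotent : forall A, cl_fun (cl_fun A) = cl_fun A;
  cl_monotone : {homo cl_fun : A B / A `<=` B}
}.

Definition algebraic {S : Type} (cl : closure_operator S) : Prop :=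
  forall A : set S,
    cl A = \bigcup_(F in [set F | finite_set F /\ F `<=` A]) cl F.

(* An alias of [set S], because [set S], being a function type, already has
   the topology of pointwise convergence. *)
Definition hull_kernel (S : Type) : Type := set S.

HB.instance Definition _ (S : Type) := Choice.copy (hull_kernel S) (set S).

Definition hull_kernel_subbase {S : Type} (F : set S) : set (hull_kernel S) :=
  [set A : set S | ~ (F `<=` A)].

HB.instance Definition _ (S : Type) :=
  isSubBaseTopological.Build (hull_kernel S)
    (@finite_set S) (@hull_kernel_subbase S).

(* As a type, [closed_sets cl] has the subspace topology, which is the one that
   the library puts on [set_type]. *)
Definition closed_sets {S : Type} (cl : closure_operator S) :
    set (hull_kernel S) :=
  [set A : set S | cl A = A].

Definition setmul {S : magmaType} (A B : set S) : set S :=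
  [set (a * b)%g | a in A & b in B].

Definition star {S : magmaType} (cl : closure_operator S)
    (A B : closed_sets cl) : closed_sets cl :=
  SigSub (mem_set (cl_idempotent cl (setmul (val A) (val B)))
    : (cl (setmul (val A) (val B)) : hull_kernel S) \in closed_sets cl).

(* The library's [compact] does not include separation: it is quasi-compactness,
   see [compact_cover]. *)
Definition spectral_map {T U : topologicalType} (f : T -> U) : Prop :=
  forall V : set U, open V -> compact V ->
    open (f @^-1` V) /\ compact (f @^-1` V).

(* Main.v *)
Require Import Defs.
From mathcomp Require Import all_boot monoid finmap.
From mathcomp Require Import all_classical topology.

Set Implicit Arguments.
Unset Strict Implicit.
Unset Printing Implicit Defensive.

Local Open Scope classical_set_scope.

(** The two translations are the same maps because [star] is commutative, and a
    translation is a section of the joint map, so the content is that separate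
    spectrality implies joint spectrality. This is a form of Lawson's theorem,
    that a separately continuous operation on a compact semilattice is jointly
    continuous, applied to the patch topology of the space [X] of closed sets.

    The patch topology is handled through ultrafilters. Along an ultrafilter [p]
    a family [y] of closed sets has the limit [plim p y] made of the points that
    lie in [p]-almost all [y i]; it is closed because [cl] is algebraic. In the
    hull-kernel topology [plim p y] is only the least limit of the family, since
    every larger closed set is also a limit, but knowing the least limits
    suffices: by [compact_open_ultraP] the quasi-compact open sets are the lower
    sets that are clopen for [plim], and by [spectral_mapP] a map into [X] is
    spectral exactly when it is monotone and commutes with [plim]. The operation
    [star] is always monotone, so what remains is to show that it commutes with
    limits in both variables together when it does so in each one.

    Let [A], [B], [E] be the limits of [a i], [b i] and [a i * b i]. The
    semilattice order ([t <= u] when [t * u = t]) enters through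
    [clopen_ultra_lower_bound]: a patch clopen set that contains the limit of a
    family contains some [t] that is below almost all of its members. Such a [t]
    is a minimal element, given by Zorn's lemma, of a suitable closed set.
    Applied to the family [a i * b i] this gives [E = A * E], and applied to the
    family [a i] it gives [A * E = A * B]; see [op_jointly_plim]. *)

(** * Ultrafilters *)

Lemma ultra_setC (T : Type) (p : set_system T) (A : set T) :
  UltraFilter p -> p (~` A) <-> ~ p A.
Proof.
move=> pU; split=> [pnA pA|npA]; last by case: (in_ultra_setVsetC A pU).
by have [x []] := filter_ex (filterI pA pnA).
Qed.

Lemma ultra_fmap (T U : Type) (f : T -> U) (p : set_system T) :
  UltraFilter p -> UltraFilter (f @ p).
Proof.
move=> pU; split=> [|G GF sfG]; first exact: fmap_proper_filter.
apply/seteqP; split=> // A GA; apply: contrapT => npA.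
have /(ultra_setC (f @^-1` A) pU) nA : ~ p (f @^-1` A) by [].
by have [x []] := filter_ex (filterI GA (sfG (~` A) nA)).
Qed.

(** * Quasi-compact open sets through least limits *)

Section LeastLimits.
Variables (T : topologicalType) (lim : set_system T -> T).

(** [nbhs x --> y] says that [x] lies in every open set that contains [y]: this
    is the specialization order, for which open sets are lower sets. *)
Definition least_limit (p : set_system T) (x : T) :=
  p --> x /\ forall y : T, p --> y -> nbhs x --> y.

Hypothesis lim_least : forall p, UltraFilter p -> least_limit p (lim p).

(** When every ultrafilter has a least limit, a compact open [V] is clopen for
    these limits: openness makes [p] contain [V] when [V] contains the limit,
    and when [p] contains [V], compactness puts some limit of [p] in [V], hence
    also the least one. Conversely, a failure of openness at [x] would give an
    ultrafilter converging to [x] and avoiding [V], whose least limit is below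
    [x] and so in [V]. *)
Lemma compact_open_ultraP (V : set T) :
  open V /\ compact V <->
  (forall x y : T, nbhs x --> y -> V y -> V x) /\
  (forall p, UltraFilter p -> V (lim p) <-> p V).
Proof.
have open_lower (W : set T) (x y : T) : open W -> nbhs x --> y -> W y -> W x.
  by move=> oW xy Wy; apply: nbhs_singleton; apply: xy; exact: open_nbhs_nbhs.
split=> [[oV cV]|[lowV limV]]; split.
- by move=> x y; exact: open_lower.
- move=> p pU; have [pl le_l] := lim_least pU; split=> [Vl|pV].
    by apply: pl; exact: open_nbhs_nbhs.
  have [y [Vy /le_l ly]] : V `&` [set y | p --> y] !=set0.
    by move: cV; rewrite compact_ultra; apply.
  exact: open_lower ly Vy.
- rewrite openE => x Vx; apply: contrapT => nVx.
  have nF : ProperFilter (within (~` V) (nbhs x)).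
    apply: Build_ProperFilter => W0; apply: nVx.
    move: W0; rewrite /within /=; apply: filterS => y nVy.
    by apply: contrapT => /nVy.
  have [p [pU sp]] := ultraFilterLemma nF.
  have px : p --> x by move=> W xW; apply: sp; apply: filterS xW => y ? ?.
  have /(ultra_setC V pU) : p (~` V) by apply: sp; exact: withinT.
  by apply; apply/limV => //; apply: lowV Vx; exact: (lim_least pU).2.
- rewrite compact_ultra => p pU pV; exists (lim p); split; first exact/limV.
  exact: (lim_least pU).1.
Qed.

End LeastLimits.

Lemma cvg_prod_fst_snd (T U : topologicalType) (p : set_system (T * U)) (x : T) (y : U) :
  p --> (x, y) -> fst @ p --> x /\ snd @ p --> y.
Proof.
move=> pxy; split=> P.
  by move=> /(@cvg_fst _ _ (nbhs x) (nbhs y) _); exact: pxy.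
by move=> /(@cvg_snd _ _ (nbhs x) (nbhs y) _); exact: pxy.
Qed.

Lemma nbhs_prod_cvg (T U : topologicalType) (x x' : T) (y y' : U) :
  nbhs (x, y) --> (x', y') -> nbhs x --> x' /\ nbhs y --> y'.
Proof.
move=> /cvg_prod_fst_snd[xx' yy']; split=> P.
  move=> /xx'[[P1 P2] [/= xP1 yP2] sP]; apply: filterS xP1 => z P1z.
  by apply: (sP (z, y)); split=> //; exact: nbhs_singleton.
move=> /yy'[[P1 P2] [/= xP1 yP2] sP]; apply: filterS yP2 => z P2z.
by apply: (sP (x, z)); split=> //; exact: nbhs_singleton.
Qed.

(** * Ultrafilter limits of closed sets *)

Section ClosedSets.
Variables (S : choiceType) (cl : closure_operator S).
Hypothesis cl_alg : algebraic cl.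
Local Notation X := (closed_sets cl).

(** By [val_plim] the closure adds no point to the underlying set when [p] is a
    filter; taking it makes [plim] a total function of [p]. *)
Definition plim {I : Type} (p : set_system I) (y : I -> X) : X :=
  SigSub (mem_set (cl_idempotent cl [set s | p [set i | val (y i) s]])
    : (cl _ : hull_kernel S) \in closed_sets cl).

Lemma cl_val (A : X) : cl (val A) = val A.
Proof. exact: set_mem (valP A). Qed.

Lemma closed_setsP (A B : X) : (forall s, val A s <-> val B s) -> A = B.
Proof. by move=> AB; apply/val_inj/seteqP; split=> s /AB. Qed.

Lemma filter_finite_subset (I : Type) (p : set_system I) (y : I -> set S)
    (F : set S) : Filter p -> finite_set F ->
  (forall s, F s -> p [set i | y i s]) -> p [set i | F `<=` y i].
Proof.
move=> pF /finite_fsetP[G ->] pG.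
have : p (\bigcap_(s in [set` G]) [set i | y i s]).
  by apply: filter_bigI => s Gs; exact: pG.
by apply: filterS => i yi s Gs; exact: yi.
Qed.

(** If [s] is in the closure of the points shared by almost all [y i], then by
    algebraicity it is in the closure of finitely many of them; these lie
    together in almost all [y i], which are closed and so contain [s]. *)
Lemma val_plim (I : Type) (p : set_system I) (y : I -> X) (s : S) :
  Filter p -> val (plim p y) s <-> p [set i | val (y i) s].
Proof.
move=> pF; split=> [|ys]; last exact: cl_extensive.
rewrite /= cl_alg => -[F [finF sF] Fs].
have := filter_finite_subset pF finF sF.
by apply: filterS => i sFy /=; rewrite -cl_val; exact: cl_monotone Fs.
Qed.

(** Singletons suffice as indices of the subbase: if [F] is not included in [A],
    one point of [F] outside [A] already shows it. *)
Lemma hull_kernel_cvgP (p : set_system (hull_kernel S)) (A : hull_kernel S) :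
  Filter p -> p --> A <-> forall s, ~ A s -> p [set B : set S | ~ B s].
Proof.
move=> pF; split=> [pA s nAs|pA].
  apply: pA; apply: open_nbhs_nbhs; split=> //.
  exists [set [set B : set S | ~ B s]]; last first.
    by apply/seteqP; split=> [B [_ ->]|B Bs] //; exists [set B : set S | ~ B s].
  move=> _ ->; exists [fset [set s]]%fset.
    by move=> F /fset1P ->; exact/mem_set/finite_set1.
  apply/seteqP; split=> B.
    by move=> /(_ [set s] (fset11 _)) + Bs; apply=> _ ->.
  by move=> nBs F /fset1P -> /(_ s erefl).
move=> W; rewrite nbhsE => -[V [[E sE <-] [V' EV' V'A]] sVW].
apply: filterS sVW _; apply: (@filterS _ _ _ V'); first by move=> B ?; exists V'.
have [G sG GV'] := sE _ EV'; rewrite -GV' in V'A *.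
apply: filter_bigI => F GF; have /existsNP[s /not_implyP[Fs nAs]] := V'A F GF.
by apply: filterS (pA _ nAs) => B nBs /(_ s Fs).
Qed.

Lemma closed_sets_cvgP (p : set_system X) (A : X) : Filter p ->
  p --> A <-> forall s, ~ val A s -> p [set B : X | ~ val B s].
Proof.
move=> pF; split=> [pA s nAs|pA].
  have : (val : X -> hull_kernel S) @ p --> (val A : hull_kernel S).
    apply: cvg_trans (@initial_continuous X (hull_kernel S) set_val A).
    by move=> W /pA.
  by move/hull_kernel_cvgP; apply.
have vA : (val : X -> hull_kernel S) @ p --> (val A : hull_kernel S).
  by apply/hull_kernel_cvgP.
move=> W; rewrite nbhsE => -[V [[V' oV' <-] V'A] sVW].
by apply: filterS sVW _; apply: vA; exact: open_nbhs_nbhs.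
Qed.

Lemma nbhs_closed_setsP (A B : X) : nbhs A --> B <-> val A `<=` val B.
Proof.
rewrite closed_sets_cvgP; split=> [AB s As|AB s nBs].
  by apply: contrapT => /AB /nbhs_singleton.
by apply (closed_sets_cvgP A _).1 => // /AB.
Qed.

Lemma plim_least (p : set_system X) :
  UltraFilter p -> least_limit p (plim p id).
Proof.
move=> pU; split=> [|A /closed_sets_cvgP pA].
  by apply/closed_sets_cvgP => s /(val_plim id s) /(ultra_setC _ pU).
apply/nbhs_closed_setsP => s /(val_plim id s) ps.
by apply: contrapT => /pA; apply/(ultra_setC _ pU).
Qed.

Lemma plim_least2 (p : set_system (X * X)) :
  UltraFilter p -> least_limit p (plim p fst, plim p snd).
Proof.
move=> pU; have [p1 le1] := plim_least (ultra_fmap fst pU).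
have [p2 le2] := plim_least (ultra_fmap snd pU); split=> [|[A B] pAB].
  move=> Q [[P1 P2] [/= /p1 pP1 /p2 pP2] sPQ].
  by apply: filterS sPQ _; exact: filterI.
have [pA pB] := cvg_prod_fst_snd pAB.
move=> Q [[P1 P2] [/= /(le1 _ pA) AP1 /(le2 _ pB) BP2] sPQ].
by exists (P1, P2).
Qed.

Lemma compact_open_notin (s : S) :
  open [set A : X | ~ val A s] /\ compact [set A : X | ~ val A s].
Proof.
apply/(compact_open_ultraP plim_least); split=> [A B /nbhs_closed_setsP AB|p pU].
  by apply: contra_not => /AB.
split=> [nAs|/(ultra_setC [set A : X | val A s] pU) npA /(val_plim id s) //].
by apply/(ultra_setC [set A : X | val A s] pU) => /(val_plim id s).
Qed.

(** The sets of closed sets avoiding a given point are compact open, and they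
    detect both inclusion and [plim]; this gives the direct implication. *)
Lemma spectral_mapP (T : topologicalType) (lim : set_system T -> T) (f : T -> X) :
  (forall p, UltraFilter p -> least_limit p (lim p)) ->
  spectral_map f <->
  (forall x y : T, nbhs x --> y -> val (f x) `<=` val (f y)) /\
  (forall p, UltraFilter p -> f (lim p) = plim p f).
Proof.
move=> limP; split=> [spf|[fmon flim] V].
  have spD s : (forall x y : T, nbhs x --> y -> ~ val (f y) s -> ~ val (f x) s) /\
      (forall p, UltraFilter p -> ~ val (f (lim p)) s <-> p [set x | ~ val (f x) s]).
    have [oD cD] := compact_open_notin s.
    exact/(compact_open_ultraP limP)/(spf [set A | ~ val A s]).
  split=> [x y xy s|p pU].
    by apply: contraPP; apply: (spD s).1.
  apply: closed_setsP => s; rewrite val_plim.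
  have := (spD s).2 p pU; rewrite (ultra_setC [set x | val (f x) s] pU).
  exact: (iff_not2 _ _).1.
move=> oV cV; have /(compact_open_ultraP plim_least)[lV limV] := conj oV cV.
apply/(compact_open_ultraP limP); split=> [x y xy|p pU].
  by apply: lV; apply/nbhs_closed_setsP; exact: fmon.
rewrite /preimage /= flim //; exact: (limV (f @ p) (ultra_fmap f pU)).
Qed.

Lemma eq_plim (I : Type) (p : set_system I) (y z : I -> X) : Filter p ->
  p [set i | y i = z i] -> plim p y = plim p z.
Proof.
move=> pF yz; apply: closed_setsP => s; rewrite !val_plim.
by split; apply: filterS2 yz => i /= ->.
Qed.

(** * Joint continuity from separate continuity *)

Section Lawson.
Variable op : X -> X -> X.
Hypothesis op_semilattice : is_semilattice op.
Hypothesis op_plim : forall (A : X) (I : Type) (p : set_system I) (y : I -> X),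
  UltraFilter p -> op A (plim p y) = plim p (fun i => op A (y i)).

Let opA : associative op := let: And3 h _ _ := op_semilattice in h.
Let opC : commutative op := let: And3 _ h _ := op_semilattice in h.
Let opxx : idempotent_op op := let: And3 _ _ h := op_semilattice in h.

(** The clopen sets of the compact Hausdorff topology whose ultrafilter limits
    are given by [plim], that is, of the patch topology. *)
Definition patch_clopen (U : set X) := forall (I : Type) (p : set_system I)
  (y : I -> X), UltraFilter p -> U (plim p y) <-> p [set i | U (y i)].

Lemma patch_clopen_mem (s : S) : patch_clopen [set A | val A s].
Proof. by move=> I p y pU; exact: val_plim. Qed.

Lemma patch_clopenC (U : set X) : patch_clopen U -> patch_clopen (~` U).
Proof.
move=> cU I p y pU; rewrite (ultra_setC [set i | U (y i)] pU) /setC /=.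
by rewrite cU.
Qed.

Lemma patch_clopenI (U V : set X) :
  patch_clopen U -> patch_clopen V -> patch_clopen (U `&` V).
Proof.
move=> cU cV I p y pU; rewrite /setI /= cU cV.
split=> [[pUy pVy]|pUV]; first exact: filterI.
by split; apply: filterS pUV => i [].
Qed.

Lemma patch_clopen_op (A : X) (U : set X) :
  patch_clopen U -> patch_clopen [set B | U (op A B)].
Proof. by move=> cU I p y pU /=; rewrite op_plim // cU. Qed.

(** The lower bound of a chain is its limit along an ultrafilter containing all
    the tails of the chain: as translations commute with limits, the limit
    absorbs every element of the chain. *)
Lemma chain_lower_bound (T : set X) (C : set T) : patch_clopen T -> T !=set0 ->
  total_on C (fun c d => op (val c) (val d) = val d) ->
  exists l : T, forall c, C c -> op (val c) (val l) = val l.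
Proof.
move=> cT [t0 Tt0] totC.
have [[c0 Cc0]|/set0P/negP/negPn/eqP ->] := pselect (C !=set0); last first.
  by exists (SigSub (mem_set Tt0)).
pose below (c : T) := [set d : T | C d /\ op (val c) (val d) = val d].
have tailsF : ProperFilter (filter_from C below).
  apply: filter_from_proper => [|c Cc]; last by exists c; split.
  apply: filter_from_filter; first by exists c0.
  move=> c d Cc Cd; have [cd|dc] := totC c d Cc Cd.
    exists d => // x [Cx dx]; split; split=> //.
    by rewrite -[in LHS]dx opA cd.
  exists c => // x [Cx cx]; split; split=> //.
  by rewrite -[in LHS]cx opA dc.
have [p [pU sp]] := ultraFilterLemma tailsF.
have Tl : T (plim p val) by apply/cT; apply: filterE => c; exact: set_mem (valP c).
exists (SigSub (mem_set Tl)) => c Cc /=; rewrite op_plim //; apply: eq_plim.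
by apply: sp; exists c => // d [].
Qed.

(** Let [e] be the limit of [y]. The set [T] of those [t] in [W] with [t * e] in
    [W] is patch clopen, contains [e], and is stable under multiplication by
    [e]. So for [t] in [T], almost all products [t * y i] are again in [T], and
    when [t] is minimal in [T] they are equal to [t]. *)
Lemma clopen_ultra_lower_bound (W : set X) (I : Type) (p : set_system I) (y : I -> X) :
  UltraFilter p -> patch_clopen W -> W (plim p y) ->
  exists t, W t /\ p [set i | op t (y i) = t].
Proof.
set e := plim p y => pU cW We; pose T := W `&` [set t | W (op e t)].
have cT : patch_clopen T by apply: patch_clopenI => //; exact: patch_clopen_op.
have Te : T e by split=> //=; rewrite opxx.
(* Zorn's lemma gives a maximal element: R c d says that d <= c. *)
pose R (c d : T) := `[< op (val c) (val d) = val d >].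
have [||||t tmin] := @Zorn T R.
- by move=> t; exact/asboolP.
- by move=> r s t /asboolP rs /asboolP st; apply/asboolP; rewrite -st opA rs.
- move=> s t /asboolP st /asboolP ts; apply: val_inj.
  by rewrite -ts opC st.
- move=> C totC; have [|l lP] := @chain_lower_bound T C cT (ex_intro _ e Te).
    move=> c d Cc Cd.
    by have [/asboolP|/asboolP] := totC c d Cc Cd; [left|right].
  by exists l => c Cc; apply/asboolP; exact: lP.
have [Wt Wet] : T (val t) := set_mem (valP t).
have /(patch_clopen_op (val t) cT y pU) Tty : T (op (val t) e).
  by split; rewrite /= opC // -opA opxx opC.
exists (val t); split=> //; apply: filterS Tty => i Tti.
have /tmin/(congr1 val) : R t (SigSub (mem_set (Tti : T (op (val t) (y i))))).
  by apply/asboolP; rewrite /= opA opxx.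
by [].
Qed.

(** Let [E] be the right-hand side, and [A], [B] the limits of [a] and [b]. It is
    enough to show that a patch clopen [U] containing [E] contains [A * B], as the
    complement of [U] is patch clopen too. *)
Lemma op_jointly_plim (I : Type) (p : set_system I) (a b : I -> X) :
  UltraFilter p ->
  op (plim p a) (plim p b) = plim p (fun i => op (a i) (b i)).
Proof.
move=> pU; set A := plim p a; set B := plim p b; pose ab i := op (a i) (b i).
rewrite -/ab; set E := plim p ab.
have sep (U : set X) : patch_clopen U -> U E -> U (op A B).
  move=> cU UE.
  (* Otherwise some t is below almost all a i * b i, hence below almost all a i,
     with t in U but A * t not in U; yet A * t is the limit of a i * t = t. *)
  have UAE : U (op A E).
    apply: contrapT => nUAE.
    have [|//|t [[Ut nUAt] tE]] :=
        @clopen_ultra_lower_bound (U `&` [set t | ~ U (op A t)]) I p ab pU.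
      by apply: patch_clopenI => //; exact: patch_clopen_op (patch_clopenC cU).
    apply: nUAt; rewrite opC; apply/(patch_clopen_op t cU _ pU).
    apply: filterS tE => i /= tab.
    suff -> : op t (a i) = t by [].
    by rewrite -[in LHS]tab -opA (opC _ (a i)) (opA (a i)) opxx tab.
  (* Otherwise the limit A of the a i satisfies E * A in U and B * A not in U, so
     some t below almost all a i has E * t in U and B * t not in U; yet
     t * (a i * b i) = t * b i for almost all i, so t * E = t * B. *)
  apply: contrapT => nUAB.
  have [||t [[UEt nUBt] tA]] :=
      @clopen_ultra_lower_bound ([set t | U (op E t)] `&` [set t | ~ U (op B t)]) I p a pU.
  - apply: patch_clopenI; first exact: patch_clopen_op.
    exact: patch_clopen_op (patch_clopenC cU).
  - by split=> /=; rewrite opC.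
  apply: nUBt; rewrite opC; apply/(patch_clopen_op t cU _ pU).
  move: UEt; rewrite /= opC => /(patch_clopen_op t cU ab pU) tab.
  by apply: filterS2 tA tab => i /= ta; rewrite opA ta.
apply: closed_setsP => s; split=> [|Es]; last exact: sep (patch_clopen_mem s) Es.
apply: contraPP => /= nEs.
exact: sep (patch_clopenC (patch_clopen_mem s)) nEs.
Qed.

End Lawson.

End ClosedSets.

(** * The equivalence *)

Lemma val_star_mono (S : magmaType) (cl : closure_operator S)
    (A A' B B' : closed_sets cl) :
  val A `<=` val A' -> val B `<=` val B' ->
  val (star A B) `<=` val (star A' B').
Proof.
move=> AA BB; apply: cl_monotone => _ [a Aa [b Bb <-]].
by exists a; [exact: AA|exists b; [exact: BB|]].
Qed.

Theorem proposition4p15 (S : semilatticeOrderedSemigroupType)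
    (cl : closure_operator S) (cl_alg : algebraic cl)
    (star_semilattice : is_semilattice (@star S cl)) :
  [<-> spectral_map (fun AB : closed_sets cl * closed_sets cl =>
         star AB.1 AB.2);
       forall B : closed_sets cl,
         spectral_map (fun A : closed_sets cl => star A B);
       forall A : closed_sets cl,
         spectral_map (fun B : closed_sets cl => star A B)].
Proof.
have [_ starC _] := star_semilattice.
have lim1 := plim_least cl_alg; have lim2 := plim_least2 cl_alg.
tfae.
  (* A translation commutes with limits: push p forward along A |-> (A, B). *)
- move=> /(spectral_mapP cl_alg _ lim2)[_ slim] B.
  apply/(spectral_mapP cl_alg _ lim1); split.
    by move=> A A' /nbhs_closed_setsP AA; exact: val_star_mono.
  move=> p pU; have /= := slim _ (ultra_fmap (fun A => (A, B)) pU).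
  have -> : plim ((fun A => (A, B)) @ p) snd = B; last by [].
  apply: closed_setsP => s.
  rewrite (val_plim cl_alg snd s (fmap_filter _ _)) fmapE.
  by split=> [/filter_const|Bs] //; exact: filterE.
- by move=> spR A; under eq_fun do rewrite starC; exact: spR.
- move=> spL; apply/(spectral_mapP cl_alg _ lim2); split.
    move=> [A B] [A' B'] /nbhs_prod_cvg[AA BB].
    by apply: val_star_mono; exact/nbhs_closed_setsP.
  move=> p pU; apply: op_jointly_plim => // A I q y qU.
  have /(spectral_mapP cl_alg _ lim1)[_ /(_ _ (ultra_fmap y qU))] := spL A.
  by [].
Qed.
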